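(* Let $n\ge2$ and let $\widetilde{\boldsymbol N}_{n,2,1}$ be the free $\mathbb Z[q^{\pm1},s^{\pm1}][t^{\pm1}]$-module (where $q,s,t$ are indeterminates) with basis the $\binom n2+n-1$ vectors $b'_1,\dots,b'_{n-1}$ and $w_{i,j}$, $1\le i<j\le n$. Then $\widetilde{\boldsymbol N}_{n,2,1}$ is a representation of the braid group $B_n$, where the Artin generators $\sigma_1,\dots,\sigma_{n-1}$ act on the $w_{i,j}$ by $\sigma_i w_{j,k}=w_{j,k}$ if $\{i,i+1\}\cap\{j,k\}=\emptyset$; $\sigma_i w_{i+1,j}=s^{-1}w_{i,j}$ ($j>i+1$); $\sigma_i w_{j,i+1}=s^{-1}w_{j,i}$ ($j<i$); $\sigma_i w_{i,j}=s^{-1}w_{i+1,j}+(1-s^{-2})w_{i,j}-s^{i-j-1}(1-s^{-2})q^2w_{i,i+1}$ ($j>i+1$); $\sigma_i w_{i,i+1}=s^{-4}q^2w_{i,i+1}$; $\sigma_i w_{j,i}=s^{-1}w_{j,i+1}+(1-s^{-2})w_{j,i}-s^{i-j-1}(1-s^{-2})w_{i,i+1}$ ($j<i$); and on the $b'_j$ by $\sigma_i b'_j=b'_j$ for $i\ne n-1$ and $j\ne i,i+1$; $\sigma_i b'_i=s^{i-n}t\,w_{i,i+1}+(1-s^{-2})b'_i+s^{-1}b'_{i+1}$ for $i\neq n-1$; $\sigma_i b'_{i+1}=s^{-1}b'_i$ for $i\ne n-1$; $\sigma_{n-1}b'_j=b'_j-s^{n-j-1}b'_{n-1}$ for $j\ne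 n-1$; $\sigma_{n-1}b'_{n-1}=s^{-1}t\,w_{n-1,n}-s^{-2}b'_{n-1}$.
   Context: $B_n$ is the braid group on $n$ strands with its standard presentation by $\sigma_1,\dots,\sigma_{n-1}$. The formulas on the $w_{i,j}$ are those of the two-variable Lawrence–Krammer–Bigelow representation. *)

(* Defs.v *)
From HB Require Import structures.
From mathcomp Require Import all_boot all_order all_algebra.
From mathcomp Require Import boolp.

Set Implicit Arguments.
Unset Strict Implicit.
Unset Printing Implicit Defensive.

Import GRing.Theory.

Local Open Scope ring_scope.
Local Open Scope quotient_scope.

(* The Laurent polynomial ring R[X, X^-1] over an integral domain R, realised  *)
(* as the subring of the fractions p / X^k inside Frac(R[X]).                  *)
Section Laurent.
Variable R : idomainType.

Local Notation "x %:F" := (FracField.tofrac x).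

Definition laurent_pred : pred {fraction {poly R}} :=
  fun x => `[< exists (p : {poly R}) (k : nat), x = p%:F / ('X^k)%:F >].

Lemma fracX_neq0 k : ('X^k : {poly R})%:F != 0.
Proof. by rewrite tofrac_eq0 monic_neq0 // monicXn. Qed.

Lemma laurent_subring : subring_closed laurent_pred.
Proof.
split.
- by apply/asboolP; exists 1, 0%N; rewrite expr0 tofrac1 divr1.
- move=> _ _ /asboolP[p [k ->]] /asboolP[r [l ->]]; apply/asboolP.
  exists (p * 'X^l - r * 'X^k), (k + l)%N.
  rewrite -mulNr addf_div ?fracX_neq0 // exprD !tofracM tofracB !tofracM.
  by rewrite mulNr.
- move=> _ _ /asboolP[p [k ->]] /asboolP[r [l ->]]; apply/asboolP.
  exists (p * r), (k + l)%N.
  by rewrite exprD !tofracM mulf_div.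
Qed.

HB.instance Definition _ :=
  GRing.isSubringClosed.Build _ laurent_pred laurent_subring.

Record laurent : Type :=
  Laurent { laurent_val :> {fraction {poly R}}; _ : laurent_pred laurent_val }.

HB.instance Definition _ := [isSub for laurent_val].
HB.instance Definition _ := [Choice of laurent by <:].
HB.instance Definition _ := [SubChoice_isSubComNzRing of laurent by <:].

Definition laurent_unit : pred laurent :=
  fun x => (val x != 0) && laurent_pred (val x)^-1.

Definition laurent_inv (x : laurent) : laurent := insubd x (val x)^-1.

Lemma laurent_invE x : laurent_unit x -> val (laurent_inv x) = (val x)^-1.
Proof. by case/andP=> _ xV; rewrite /laurent_inv val_insubd xV. Qed.

Lemma laurent_mulVx : {in laurent_unit, left_inverse 1 laurent_inv *%R}.
Proof.
move=> x xu; apply: val_inj; rewrite rmorphM rmorph1 /= laurent_invE //.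
by case/andP: xu => x0 _; rewrite mulVf.
Qed.

Lemma laurent_unitPl (x y : laurent) : y * x = 1 -> laurent_unit x.
Proof.
move=> /(congr1 val); rewrite rmorphM rmorph1 => yx1.
have /norP[_ x0] : ~~ ((val y == 0) || (val x == 0)).
  by rewrite -mulf_eq0 yx1 oner_eq0.
rewrite /laurent_unit x0.
suff -> : (val x)^-1 = val y by exact: valP.
by apply: (mulIf x0); rewrite yx1 mulVf.
Qed.

Lemma laurent_inv_out : {in [predC laurent_unit], laurent_inv =1 id}.
Proof.
move=> x; rewrite inE /= /laurent_unit negb_and negbK => xN.
apply: val_inj; rewrite /laurent_inv val_insubd.
by case: ifP xN => // _; rewrite orbF => /eqP ->; rewrite invr0.
Qed.

HB.instance Definition _ := GRing.ComNzRing_hasMulInverse.Build laurent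
  laurent_mulVx laurent_unitPl laurent_inv_out.

Lemma laurent_mulf_eq0 (x y : laurent) : x * y = 0 -> (x == 0) || (y == 0).
Proof.
move=> /(congr1 val); rewrite rmorphM rmorph0 => /eqP.
by rewrite mulf_eq0 -!(inj_eq val_inj) !rmorph0.
Qed.

HB.instance Definition _ :=
  GRing.ComUnitRing_isIntegral.Build laurent laurent_mulf_eq0.

Lemma laurent_tofrac_subproof (p : {poly R}) : laurent_pred p%:F.
Proof. by apply/asboolP; exists p, 0%N; rewrite expr0 tofrac1 divr1. Qed.

Definition laurent_of_poly (p : {poly R}) : laurent :=
  Laurent (laurent_tofrac_subproof p).

Lemma laurent_of_poly_zmod_morphism : zmod_morphism laurent_of_poly.
Proof. by move=> p r; apply: val_inj; rewrite rmorphB /= tofracB. Qed.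

Lemma laurent_of_poly_monoid_morphism : monoid_morphism laurent_of_poly.
Proof.
by split=> [|p r]; apply: val_inj; rewrite (rmorph1, rmorphM) /= (tofrac1, tofracM).
Qed.

HB.instance Definition _ := GRing.isZmodMorphism.Build {poly R} laurent
  laurent_of_poly laurent_of_poly_zmod_morphism.
HB.instance Definition _ := GRing.isMonoidMorphism.Build {poly R} laurent
  laurent_of_poly laurent_of_poly_monoid_morphism.

Definition laurentC (c : R) : laurent := laurent_of_poly c%:P.
Definition laurentX : laurent := laurent_of_poly 'X.

Lemma laurentX_unit : laurentX \is a GRing.unit.
Proof.
apply/andP; split; first by rewrite /= tofrac_eq0 polyX_eq0.
by apply/asboolP; exists 1, 1%N; rewrite tofrac1 expr1 div1r.
Qed.

Lemma laurentC_unit c : c \is a GRing.unit -> laurentC c \is a GRing.unit.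
Proof. by move=> cu; rewrite /laurentC !rmorph_unit. Qed.

End Laurent.

Arguments laurentX {R}.

Section Presentation.
Variables (X : choiceType) (rel : seq (X * bool) -> seq (X * bool) -> Prop).

(* The letter (x, true) stands for x and (x, false) for x^-1. *)
Local Notation word := (seq (X * bool)).

Inductive pres_eq : word -> word -> Prop :=
| pres_refl u : pres_eq u u
| pres_sym u v : pres_eq u v -> pres_eq v u
| pres_trans u v w : pres_eq u v -> pres_eq v w -> pres_eq u w
| pres_cancel u v x e : pres_eq (u ++ [:: (x, e); (x, ~~ e)] ++ v) (u ++ v)
| pres_rel u v a b : rel a b -> pres_eq (u ++ a ++ v) (u ++ b ++ v).

Definition pres_eqb : word -> word -> bool := fun u v => `[< pres_eq u v >].

Lemma pres_eqb_refl : reflexive pres_eqb.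
Proof. by move=> u; apply/asboolP; exact: pres_refl. Qed.

Lemma pres_eqb_sym : symmetric pres_eqb.
Proof. by move=> u v; apply/asboolP/asboolP; exact: pres_sym. Qed.

Lemma pres_eqb_trans : transitive pres_eqb.
Proof.
by move=> v u w /asboolP uv /asboolP vw; apply/asboolP; exact: pres_trans uv vw.
Qed.

Canonical pres_equiv := EquivRel pres_eqb pres_eqb_refl pres_eqb_sym pres_eqb_trans.

Definition presented_group := {eq_quot pres_eqb}.

HB.instance Definition _ : EqQuotient _ pres_eqb presented_group :=
  EqQuotient.on presented_group.
HB.instance Definition _ := Choice.on presented_group.

Definition pres_class (u : word) : presented_group := \pi u.
Definition pres_gen (x : X) : presented_group := pres_class [:: (x, true)].

Lemma pres_classP u v : pres_class u = pres_class v <-> pres_eq u v.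
Proof.
by split=> [/eqmodP/asboolP // | uv]; apply/eqmodP/asboolP.
Qed.

Lemma pres_reprK a : pres_class (repr a) = a.
Proof. exact: reprK. Qed.

Lemma pres_repr_class u : pres_eq (repr (pres_class u)) u.
Proof. by apply/pres_classP; rewrite pres_reprK. Qed.

Lemma pres_eq_ctx a b u v : pres_eq u v -> pres_eq (a ++ u ++ b) (a ++ v ++ b).
Proof.
elim=> {u v}
  [u|u v _ uv|u v w _ uv _ vw|u v x e|u v c d cd].
- exact: pres_refl.
- exact: pres_sym.
- exact: pres_trans uv vw.
- by have := pres_cancel (a ++ u) (v ++ b) x e; rewrite !catA.
- by have := pres_rel (a ++ u) (v ++ b) cd; rewrite !catA.
Qed.

Lemma pres_eq_cat u u' v v' :
  pres_eq u u' -> pres_eq v v' -> pres_eq (u ++ v) (u' ++ v').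
Proof.
move=> uu' vv'; apply: (@pres_trans _ (u' ++ v)).
  exact: (pres_eq_ctx [::] v uu').
by have := pres_eq_ctx u' [::] vv'; rewrite !cats0.
Qed.

Definition word_inv (u : word) : word := rev [seq (l.1, ~~ l.2) | l <- u].

Lemma word_invK : involutive word_inv.
Proof.
move=> u; rewrite /word_inv map_rev revK -map_comp -[RHS]map_id.
by apply: eq_map => -[x e] /=; rewrite negbK.
Qed.

Lemma pres_eq_mulV u : pres_eq (u ++ word_inv u) [::].
Proof.
elim: u => [|[x e] u IHu]; first exact: pres_refl.
have -> : ((x, e) :: u) ++ word_inv ((x, e) :: u)
        = [:: (x, e)] ++ (u ++ word_inv u) ++ [:: (x, ~~ e)].
  by rewrite /word_inv /= rev_cons -cats1 !catA.
apply: pres_trans (pres_eq_ctx _ _ IHu) _.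
exact: (pres_cancel [::] [::]).
Qed.

Lemma pres_eq_Vmul u : pres_eq (word_inv u ++ u) [::].
Proof. by have := pres_eq_mulV (word_inv u); rewrite word_invK. Qed.

Lemma pres_eq_inv u v : pres_eq u v -> pres_eq (word_inv u) (word_inv v).
Proof.
move=> uv; apply: (@pres_trans _ (word_inv u ++ v ++ word_inv v)).
  apply: pres_sym; have := pres_eq_ctx (word_inv u) [::] (pres_eq_mulV v).
  by rewrite !cats0.
rewrite catA; apply: (pres_eq_ctx [::] (word_inv v) (v := [::])).
apply: pres_trans (pres_eq_Vmul u).
by apply: pres_eq_cat; [exact: pres_refl | exact: pres_sym].
Qed.

Definition pres_one : presented_group := pres_class [::].
Definition pres_mul (a b : presented_group) : presented_group :=
  pres_class (repr a ++ repr b).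
Definition pres_inv (a : presented_group) : presented_group :=
  pres_class (word_inv (repr a)).

Lemma pres_mulE u v :
  pres_mul (pres_class u) (pres_class v) = pres_class (u ++ v).
Proof. by apply/pres_classP/pres_eq_cat; exact: pres_repr_class. Qed.

Lemma pres_invE u : pres_inv (pres_class u) = pres_class (word_inv u).
Proof. by apply/pres_classP/pres_eq_inv/pres_repr_class. Qed.

Lemma pres_mulA : associative pres_mul.
Proof.
move=> a b c; rewrite -[a]pres_reprK -[b]pres_reprK -[c]pres_reprK.
by rewrite !pres_mulE catA.
Qed.

Lemma pres_1mul : left_id pres_one pres_mul.
Proof. by move=> a; rewrite -[a]pres_reprK pres_mulE. Qed.

Lemma pres_mul1 : right_id pres_one pres_mul.
Proof. by move=> a; rewrite -[a]pres_reprK pres_mulE cats0. Qed.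

Lemma pres_mulVg : left_inverse pres_one pres_inv pres_mul.
Proof.
move=> a; rewrite -[a]pres_reprK pres_invE pres_mulE.
exact/pres_classP/pres_eq_Vmul.
Qed.

Lemma pres_mulgV : right_inverse pres_one pres_inv pres_mul.
Proof.
move=> a; rewrite -[a]pres_reprK pres_invE pres_mulE.
exact/pres_classP/pres_eq_mulV.
Qed.

HB.instance Definition _ := isGroup.Build presented_group
  pres_mulA pres_1mul pres_mul1 pres_mulVg pres_mulgV.

End Presentation.

(* i : artin n stands for sigma_i with 1 <= i <= n - 1. *)
Definition artin (n : nat) : Type := {i : 'I_n | (0 < i)%N}.
HB.instance Definition _ n := Finite.on (artin n).

Definition artin_nat n (i : artin n) : nat := val (val i).
Coercion artin_nat : artin >-> nat.

Inductive braid_rel n : seq (artin n * bool) -> seq (artin n * bool) -> Prop :=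
| braid_far (i j : artin n) : (i.+1 < j)%N ->
    braid_rel [:: (i, true); (j, true)] [:: (j, true); (i, true)]
| braid_near (i j : artin n) : (j : nat) = i.+1 ->
    braid_rel [:: (i, true); (j, true); (i, true)]
              [:: (j, true); (i, true); (j, true)].

Definition braid (n : nat) : Type := presented_group (@braid_rel n).
HB.instance Definition _ n := Group.on (braid n).

Definition sigma n (i : artin n) : braid n := pres_gen (@braid_rel n) i.

Record linear_rep (G : groupType) (A : pzRingType) (V : lmodType A) := LinearRep {
  rep_fun :> G -> {linear V -> V};
  rep1 : forall v, rep_fun 1%g v = v;
  repM : forall g h v, rep_fun (g * h)%g v = rep_fun g (rep_fun h v)
}.

Definition Lam : Type := laurent (laurent (laurent int)).
HB.instance Definition _ := GRing.IntegralDomain.on Lam.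

Definition q : Lam := laurentC (laurentC laurentX).
Definition s : Lam := laurentC laurentX.
Definition t : Lam := laurentX.

Lemma q_unit : q \is a GRing.unit.
Proof. by rewrite !laurentC_unit ?laurentX_unit. Qed.

Lemma s_unit : s \is a GRing.unit.
Proof. by rewrite laurentC_unit ?laurentX_unit. Qed.

Lemma t_unit : t \is a GRing.unit.
Proof. exact: laurentX_unit. Qed.

Definition basis_index (n : nat) : Type :=
  (artin n + {p : 'I_n.+1 * 'I_n.+1 | (0 < p.1 < p.2)%N})%type.
HB.instance Definition _ n := Finite.on (basis_index n).

Lemma card_artin n : #|{: artin n}| = n.-1.
Proof.
rewrite card_sig; case: n => [|n]; first by apply: eq_card0 => -[].
rewrite (eq_card (B := predC1 ord0)); last by move=> i; rewrite !inE lt0n.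
by rewrite cardC1 card_ord.
Qed.

Lemma card_basis_index n : #|{: basis_index n}| = ('C(n, 2) + n.-1)%N.
Proof.
rewrite card_sum card_artin addnC; congr (_ + _)%N.
rewrite card_sig -sum1_card.
rewrite -(pair_big_dep xpredT (fun i j : 'I_n.+1 => (0 < i < j)%N)
            (fun _ _ => 1%N)) /=.
rewrite (exchange_big_dep xpredT) //=.
rewrite big_ord_recl big1 ?add0n; last by move=> i; rewrite ltn0 andbF.
rewrite -bin2_sum big_mkord; apply: eq_bigr => j _.
rewrite big_mkcond big_ord_recl /= add0n -big_mkcond /=.
under eq_bigl => i do rewrite /bump /= add1n ltnS.
by rewrite -(big_ord_widen n (fun _ => 1%N)) ?sum1_card ?card_ord // ltnW.
Qed.

Definition Nmod (n : nat) : Type := {ffun basis_index n -> Lam^o}.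
HB.instance Definition _ n := GRing.Lmodule.on (Nmod n).

(* b' j and w i j are the basis vectors b'_j and w_{i,j}; zero if the indices  *)
(* are out of range.                                                          *)
Definition b' n (j : nat) : Nmod n :=
  [ffun x : basis_index n =>
     match x return Lam^o with inl k => ((k : nat) == j)%:R | inr _ => 0 end].

Definition w n (i j : nat) : Nmod n :=
  [ffun x : basis_index n =>
     match x return Lam^o with
     | inl _ => 0
     | inr p => (((val p).1 == i :> nat) && ((val p).2 == j :> nat))%:R
     end].

Arguments b' {n} j.
Arguments w {n} i j.

Lemma Nmod_basis n (c : basis_index n -> Lam) :
  [ffun x => c x] = \sum_(j : artin n) c (inl j) *: b' (artin_nat j)
                    + \sum_p c (inr p) *: w (val p).1 (val p).2 :> Nmod n.
Proof.
apply/ffunP => x; rewrite !ffunE !sum_ffunE.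
case: x => [k|r].
- rewrite (bigD1 k) //= !ffunE eqxx [_ *: _]mulr1 !big1 ?addr0 // => [r _|j jk].
    by rewrite !ffunE scaler0.
  rewrite !ffunE (_ : (_ == _) = false) ?scaler0 //.
  by apply: contraNF jk => /eqP jk; apply/eqP/val_inj/val_inj.
- rewrite big1 ?add0r => [|j _]; last by rewrite !ffunE scaler0.
  rewrite (bigD1 r) //= !ffunE !eqxx [_ *: _]mulr1 big1 ?addr0 // => p pr.
  rewrite !ffunE (_ : (_ && _) = false) ?scaler0 //.
  apply: contraNF pr => /andP[/eqP r1 /eqP r2]; apply/eqP/val_inj.
  rewrite [val p]surjective_pairing [val r]surjective_pairing.
  by congr (_, _); apply: val_inj.
Qed.

(* Main.v *)
(* Put p = s^-2 and z = q^2.  Adjoin one more strand: in the free module on     *)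
(* v_{j,k}, 1 <= j < k <= n + 1, write f_j = v_{j,n+1} and embed the module by  *)
(* w_{j,k} |-> s^-(j+k) v_{j,k} and b'_j |-> s^-j (f_j - f_n).  This rescaling   *)
(* absorbs all powers of s, and both families of formulas become the single    *)
(* Krammer-type rule lkb_vec below; on f_i the coefficient of v_{i,i+1} is just *)
(* another constant, which the braid relations do not constrain.  The image of *)
(* the embedding is the kernel of the form f_j |-> 1, v_{j,k} |-> 0 (k <= n),   *)
(* which the operators leave invariant, so the relations and the cubic equation *)
(* (T - 1)(T + p)(T - p^2 z) = 0, hence invertibility, descend.                *)
From HB Require Import structures.
Require Import Defs.
From mathcomp Require Import all_boot all_order all_algebra.
From mathcomp Require Import ring zify.

Set Implicit Arguments.
Unset Strict Implicit.
Unset Printing Implicit Defensive.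

Import GRing.Theory.
Local Open Scope ring_scope.

(** On the free module with basis v_{j,k}, k <= n + 1, the operators [lkb i] with 0 < i < n satisfy
    the braid relations ([lkb_near], [lkb_far]) and a cubic equation ([lkb_cubic]), all checked on
    basis vectors. The v_{j,k} with k <= n span an invariant submodule, the Krammer part. Modulo it,
    the f_j carry the unreduced Burau representation with parameter p, whose coefficient sum
    [augmentation] is invariant ([augmentation_lkb]).

    The kernel of [augmentation] is the image of the embedding [incl] ([projK], [aug_incl]), so
    [lkb i] restricts to an operator [act i] intertwined by [incl] ([incl_act]). Since [incl] is
    injective, the braid relations and the cubic pull back to [act i]. The constant term of the
    cubic is the unit p^3 z, which makes [act i] invertible, and the universal property [pres_rep]
    yields the representation. The powers of s in the stated formulas come from the scaling built
    into [incl]. *)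

Ltac nat_eqs := repeat match goal with
  | |- context [@eq_op ?T ?a ?b] => first
    [ rewrite (_ : @eq_op T a b = true); last lia
    | rewrite (_ : @eq_op T a b = false); last lia ] end.

Ltac position_cases x i y :=
  have [y|[y|y]] : x = i \/ x = i.+1 \/ (x != i) && (x != i.+1) by lia.

(** * Linear maps determined by their values on a basis *)

Section LinearExtension.
Variables (R : comNzRingType) (J : finType) (V : lmodType R).

Definition lin_ext (A : J -> V) (u : {ffun J -> R^o}) : V :=
  \sum_x (u x : R) *: A x.

Lemma lin_ext_linear A : linear (lin_ext A).
Proof.
move=> a u v; rewrite /lin_ext scaler_sumr -big_split; apply: eq_bigr => x _.
by rewrite !ffunE scalerDl scalerA.
Qed.

HB.instance Definition _ A :=
  GRing.isLinear.Build R {ffun J -> R^o} V *:%R (lin_ext A) (lin_ext_linear A).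

Definition delta (x : J) : {ffun J -> R^o} := [ffun y => (y == x)%:R].

Lemma lin_ext_delta A x : lin_ext A (delta x) = A x.
Proof.
rewrite /lin_ext (bigD1 x) //= ffunE eqxx scale1r big1 ?addr0 // => y /negPf yx.
by rewrite ffunE yx scale0r.
Qed.

Lemma eq_linear_delta (f g : {linear {ffun J -> R^o} -> V}) :
  (forall x, f (delta x) = g (delta x)) -> f =1 g.
Proof.
move=> fg u; have -> : u = \sum_x (u x : R) *: delta x.
  apply/ffunP => y; rewrite sum_ffunE (bigD1 y) //= !ffunE eqxx [_ *: _]mulr1.
  by rewrite big1 ?addr0 // => x /negPf xy; rewrite !ffunE eq_sym xy scaler0.
by rewrite !linear_sum; apply: eq_bigr => x _; rewrite !linearZ /= fg.
Qed.

End LinearExtension.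

(** * Representations of a group given by generators and relations *)

Section PresentedRep.
Variables (A : pzRingType) (V : lmodType A) (X : choiceType).
Variable rel : seq (X * bool) -> seq (X * bool) -> Prop.
Variable L : X * bool -> {linear V -> V}.

Definition word_act (a : seq (X * bool)) : V -> V := foldr (fun l => comp (L l)) id a.

Lemma word_act_linear a : linear (word_act a).
Proof. by move=> k u v; elim: a => //= l a ->; rewrite linearP. Qed.

HB.instance Definition _ a :=
  GRing.isLinear.Build A V V *:%R (word_act a) (word_act_linear a).

Lemma word_act_cat a b v : word_act (a ++ b) v = word_act a (word_act b v).
Proof. by elim: a => //= l a ->. Qed.

(** Universal property of the presentation: cancelling x x^-1 or applying a relation inside a word
    leaves its operator unchanged, so the operator depends only on the group element. *)
Lemma pres_rep :
  (forall x e v, L (x, e) (L (x, ~~ e) v) = v) ->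
  (forall a b, rel a b -> word_act a =1 word_act b) ->
  exists rho : linear_rep (presented_group rel) V,
    forall x v, rho (pres_gen rel x) v = L (x, true) v.
Proof.
move=> LK Lrel.
have act_eq a b : pres_eq rel a b -> word_act a =1 word_act b.
  elim=> {a b} // [a b _ ab v|a b c _ ab _ bc v|a b x e v|a b c d cd v].
  - by rewrite ab.
  - by rewrite ab bc.
  - by rewrite !word_act_cat /= LK.
  - by rewrite !word_act_cat (Lrel _ _ cd).
(* A group element acts through its chosen representative word; [fE] shows that any other word of
   the class would do. *)
pose f (g : presented_group rel) : {linear V -> V} := word_act (repr g).
have fE a : f (pres_class rel a) =1 word_act a by exact/act_eq/pres_repr_class.
have f1 v : f 1%g v = v by rewrite [1%g]/(pres_one rel) fE.
have fM g h v : f (g * h)%g v = f g (f h v).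
  by rewrite [(g * h)%g]/(pres_mul g h) fE word_act_cat.
by exists (LinearRep f1 fM) => x v; rewrite fE.
Qed.

End PresentedRep.

(** * Krammer-type operators with one extra strand *)

Section LKB.
Variables (R : comNzRingType) (n : nat) (p z c : R).

Definition pair_index : finType := {x : 'I_n.+2 * 'I_n.+2 | (0 < x.1 < x.2)%N}.
Local Notation M := {ffun pair_index -> R^o}.

Definition vec (j k : nat) : M :=
  [ffun x : pair_index =>
     (((val x).1 == j :> nat) && ((val x).2 == k :> nat))%:R].

Lemma vecP j k : (0 < j < k)%N -> (k <= n.+1)%N ->
  exists x : pair_index,
    [/\ vec j k = delta R x, ((val x).1 : nat) = j & ((val x).2 : nat) = k].
Proof.
move=> jk kn; have ltj : (j < n.+2)%N by lia.
pose y : 'I_n.+2 * 'I_n.+2 := (Ordinal ltj, Ordinal (kn : (k < n.+2)%N)).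
exists (Sub y jk : pair_index); split=> //; apply/ffunP => x; rewrite !ffunE.
Qed.

Lemma delta_vec (x : pair_index) : delta R x = vec (val x).1 (val x).2.
Proof.
have [y [-> yx1 yx2]] := vecP (valP x) (ltn_ord _ : (val x).2 < n.+2)%N.
congr delta; apply/val_inj; rewrite [LHS]surjective_pairing.
by rewrite [RHS]surjective_pairing; congr (_, _); apply: val_inj.
Qed.

Lemma lin_ext_vec (V : lmodType R) (F : nat -> nat -> V) j k :
  (0 < j < k)%N -> (k <= n.+1)%N ->
  lin_ext (fun x : pair_index => F (val x).1 (val x).2) (vec j k) = F j k.
Proof.
by move=> jk kn; have [x [-> <- <-]] := vecP jk kn; rewrite lin_ext_delta.
Qed.

Definition lkb_coef (k : nat) : R := if k == n.+1 then c else - (p * (1 - p) * z).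

Definition lkb_vec (i j k : nat) : M :=
  if j == i then
    if k == i.+1 then (p ^+ 2 * z) *: vec i i.+1
    else p *: vec i.+1 k + (1 - p) *: vec i k + lkb_coef k *: vec i i.+1
  else if j == i.+1 then vec i k
  else if k == i then
    p *: vec j i.+1 + (1 - p) *: vec j i - (p * (1 - p)) *: vec i i.+1
  else if k == i.+1 then vec j i
  else vec j k.

Definition lkb (i : nat) : M -> M :=
  lin_ext (fun x : pair_index => lkb_vec i (val x).1 (val x).2).

HB.instance Definition _ i := GRing.Linear.copy (lkb i)
  (lin_ext (fun x : pair_index => lkb_vec i (val x).1 (val x).2)).

Lemma lkbE i j k : (0 < j < k)%N -> (k <= n.+1)%N ->
  lkb i (vec j k) = lkb_vec i j k.
Proof. exact: (@lin_ext_vec _ (lkb_vec i)). Qed.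

Lemma eq_linear_vec (V : lmodType R) (f g : {linear M -> V}) :
  (forall j k, (0 < j < k)%N -> (k <= n.+1)%N -> f (vec j k) = g (vec j k)) ->
  f =1 g.
Proof.
move=> fg; apply: eq_linear_delta => x; rewrite delta_vec fg ?(valP x) //.
exact: (ltn_ord (val x).2).
Qed.

Lemma lkbD i : {morph lkb i : u v / u + v}. Proof. exact: linearD. Qed.
Lemma lkbN i : {morph lkb i : u / - u}. Proof. exact: linearN. Qed.
Lemma lkbZ i a : {morph lkb i : u / a *: u}. Proof. exact: linearZ. Qed.

Ltac lkb_eval := repeat (rewrite ?(lkbD, lkbN, lkbZ);
  rewrite lkbE; [| lia | lia]; rewrite /lkb_vec; nat_eqs).
(** Basis vectors are generalised to arbitrary functions and compared pointwise, which leaves a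
    polynomial identity between coefficients. *)
Ltac module_eq :=
  rewrite /lkb_coef; nat_eqs;
  repeat match goal with |- context [vec ?a ?b] => move: (vec a b) => ? end;
  apply/ffunP => ?; rewrite ?ffunE /GRing.scale /=; ring.

(** Only the positions of j and k relative to i, i+1, i+2 matter. For k beyond i+2 the test
    [k == n.+1] stays undecided and [lkb_coef k] is an indeterminate for [ring]: both sides depend
    on it linearly, which is why the last column may carry its own constant c. *)
Lemma lkb_near i : (0 < i)%N -> (i.+1 < n)%N ->
  forall u, lkb i (lkb i.+1 (lkb i u)) = lkb i.+1 (lkb i (lkb i.+1 u)).
Proof.
move=> i0 lt_in.
apply: (eq_linear_vec (f := lkb i \o (lkb i.+1 \o lkb i))
                      (g := lkb i.+1 \o (lkb i \o lkb i.+1))) => j k jk kn /=.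
have [j_i|[j_i|[j_i|j_i]]] :
    j = i \/ j = i.+1 \/ j = i.+2 \/ [&& j != i, j != i.+1 & j != i.+2] by lia.
all: have [k_i|[k_i|[k_i|k_i]]] :
    k = i \/ k = i.+1 \/ k = i.+2 \/ [&& k != i, k != i.+1 & k != i.+2] by lia.
all: try (exfalso; lia).
all: subst; lkb_eval; module_eq.
Qed.

Lemma lkb_far i h : (0 < i)%N -> (i.+1 < h)%N -> (h < n)%N ->
  forall u, lkb i (lkb h u) = lkb h (lkb i u).
Proof.
move=> i0 lt_ih lt_hn.
apply: (eq_linear_vec (f := lkb i \o lkb h) (g := lkb h \o lkb i)) => j k jk kn /=.
position_cases j i j_i; position_cases j h j_h; position_cases k i k_i; position_cases k h k_h.
all: try (exfalso; lia).
all: subst; lkb_eval; module_eq.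
Qed.

(** This is the expanded form of (T - 1)(T + p)(T - p^2 z) = 0. It provides an inverse without
    formulas for sigma_i^-1 on the basis. *)
Lemma lkb_cubic i : (0 < i < n)%N -> forall u,
  lkb i (lkb i (lkb i u)) = (1 - p + p ^+ 2 * z) *: lkb i (lkb i u)
    + (p - (1 - p) * (p ^+ 2 * z)) *: lkb i u - (p ^+ 3 * z) *: u.
Proof.
move=> lt_in.
apply: (eq_linear_vec (f := lkb i \o (lkb i \o lkb i))
  (g := (((1 - p + p ^+ 2 * z) \*: (lkb i \o lkb i))
         \+ ((p - (1 - p) * (p ^+ 2 * z)) \*: lkb i))
        \- ((p ^+ 3 * z) \*: idfun))) => j k jk kn /=.
position_cases j i j_i; position_cases k i k_i.
all: try (exfalso; lia).
all: subst; lkb_eval; module_eq.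
Qed.

Definition augmentation : M -> R^o :=
  lin_ext (fun x : pair_index => ((val x).2 == n.+1 :> nat)%:R : R^o).
HB.instance Definition _ := GRing.Linear.copy augmentation
  (lin_ext (fun x : pair_index => ((val x).2 == n.+1 :> nat)%:R : R^o)).

Lemma augmentation_vec j k : (0 < j < k)%N -> (k <= n.+1)%N ->
  augmentation (vec j k) = (k == n.+1)%:R.
Proof. exact: (@lin_ext_vec _ (fun _ k => (k == n.+1)%:R : R^o)). Qed.

(** The one nontrivial check is p + (1 - p) = 1, on f_i; since i < n, the vector v_{i,i+1} lies
    outside the last column and contributes 0. *)
Lemma augmentation_lkb i : (0 < i < n)%N -> forall u,
  augmentation (lkb i u) = augmentation u.
Proof.
move=> lt_in; apply: (eq_linear_vec (f := augmentation \o lkb i)) => j k jk kn /=.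
position_cases j i j_i; position_cases k i k_i.
all: try (exfalso; lia).
all: subst; lkb_eval; rewrite ?(linearD, linearN, linearZ) /=.
all: rewrite !augmentation_vec; try lia.
all: nat_eqs; rewrite /GRing.scale /=; try ring.
Qed.

End LKB.

(** * Pulling identities back along an injective map; inverses from a cubic equation *)

Section Transport.
Variables (V W : Type) (f : V -> W) (g1 g2 : V -> V) (h1 h2 : W -> W).
Hypotheses (f_inj : injective f).
Hypotheses (fg1 : forall x, f (g1 x) = h1 (f x)) (fg2 : forall x, f (g2 x) = h2 (f x)).

Lemma commute_transport : (forall y, h1 (h2 y) = h2 (h1 y)) ->
  forall x, g1 (g2 x) = g2 (g1 x).
Proof. by move=> hE x; apply: f_inj; rewrite !(fg1, fg2) hE. Qed.

Lemma braid_transport : (forall y, h1 (h2 (h1 y)) = h2 (h1 (h2 y))) ->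
  forall x, g1 (g2 (g1 x)) = g2 (g1 (g2 x)).
Proof. by move=> hE x; apply: f_inj; rewrite !(fg1, fg2) hE. Qed.

End Transport.

Section Cubic.
Variables (R : comUnitRingType) (V : lmodType R) (g : {linear V -> V}).
Variables e1 e2 e3 : R.

Lemma cubic_transport (W : lmodType R) (f : {linear V -> W}) (h : W -> W) :
  injective f -> (forall x, f (g x) = h (f x)) ->
  (forall y, h (h (h y)) = e1 *: h (h y) + e2 *: h y - e3 *: y) ->
  forall x, g (g (g x)) = e1 *: g (g x) + e2 *: g x - e3 *: x.
Proof.
move=> f_inj fg hE x; apply: f_inj; rewrite linearB linearD !linearZ /= !fg.
by rewrite hE scalerN.
Qed.

(** The cubic rearranges to g (e1 g + e2 - g^2) = e3, so the inverse is a polynomial in g. *)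
Definition cubic_inv (x : V) : V := e3^-1 *: (e1 *: g x + e2 *: x - g (g x)).

HB.instance Definition _ := GRing.Linear.copy cubic_inv
  (e3^-1 \*: (((e1 \*: g) \+ (e2 \*: idfun)) \- (g \o g))).

Hypothesis g_cubic :
  forall x, g (g (g x)) = e1 *: g (g x) + e2 *: g x - e3 *: x.
Hypothesis e3_unit : e3 \is a GRing.unit.

Lemma cubic_invK : cancel cubic_inv g.
Proof.
move=> x; rewrite linearZ /= -[RHS]scale1r -(mulVr e3_unit) -[RHS]scalerA.
congr (_ *: _).
by rewrite linearB linearD !linearZ /= g_cubic opprB addrC subrK.
Qed.

Lemma cubicK : cancel g cubic_inv.
Proof.
move=> x; rewrite /cubic_inv g_cubic opprB addrC subrK.
by rewrite scalerA mulVr // scale1r.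
Qed.

End Cubic.

(** * Restriction to the kernel of the augmentation *)

Section Action.
Variables (R : comUnitRingType) (n : nat) (q s t : R).
Hypothesis n_gt0 : (0 < n)%N.
Hypotheses (q_unit : q \is a GRing.unit) (s_unit : s \is a GRing.unit).

Local Notation N := {ffun basis_index n -> R^o}.

Definition vec_b (j : nat) : N :=
  [ffun x : basis_index n =>
     match x return R^o with inl k => ((k : nat) == j)%:R | inr _ => 0 end].

Definition vec_w (j k : nat) : N :=
  [ffun x : basis_index n =>
     match x return R^o with
     | inl _ => 0
     | inr p => (((val p).1 == j :> nat) && ((val p).2 == k :> nat))%:R
     end].

Local Notation u := (s^-1).
Local Notation M := {ffun pair_index n -> R^o}.
Local Notation vec := (@vec R n).
(** The constant c = s^-(n+1) t is dictated by the coefficient of w_{i,i+1} in sigma_i b'_i: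
    rescaling gives s^-i c s^(2i+1) = s^(i-n) t. *)
Local Notation lkb := (@lkb R n (u ^+ 2) (q ^+ 2) (u ^+ n.+1 * t)).
Local Notation lkb_vec := (@lkb_vec R n (u ^+ 2) (q ^+ 2) (u ^+ n.+1 * t)).
Local Notation aug := (@augmentation R n).

Lemma s_expK m : u ^+ m * s ^+ m = 1.
Proof. by rewrite exprVn mulVr // unitrX // s_unit. Qed.

Lemma delta_b (j : artin n) : delta R (inl j : basis_index n) = vec_b j.
Proof. by apply/ffunP => -[k|x]; rewrite !ffunE. Qed.

Lemma delta_w (x : {x : 'I_n.+1 * 'I_n.+1 | (0 < x.1 < x.2)%N}) :
  delta R (inr x : basis_index n) = vec_w (val x).1 (val x).2.
Proof. by apply/ffunP => -[k|y]; rewrite !ffunE. Qed.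

Lemma bP j : (0 < j < n)%N ->
  exists2 i : artin n, vec_b j = delta R (inl i : basis_index n) & (i : nat) = j.
Proof.
move=> /andP[j0 jn]; exists (Sub (Ordinal jn) j0 : artin n) => //.
by rewrite delta_b.
Qed.

Lemma wP j k : (0 < j < k)%N -> (k <= n)%N ->
  exists x : {x : 'I_n.+1 * 'I_n.+1 | (0 < x.1 < x.2)%N},
    [/\ vec_w j k = delta R (inr x : basis_index n),
        ((val x).1 : nat) = j & ((val x).2 : nat) = k].
Proof.
move=> jk kn; have jn : (j < n.+1)%N by lia.
exists (Sub (Ordinal jn, Ordinal (kn : (k < n.+1)%N)) jk).
by split=> //; rewrite delta_w.
Qed.

(* [vec_b n] is out of range, which is why [proj] kills [f_n]. *)
Lemma b_out : vec_b n = 0.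
Proof.
apply/ffunP => -[k|x]; rewrite !ffunE //; case: eqP => // kn.
by have := ltn_ord (val k); rewrite /= -[X in (_ < X)%N]kn ltnn.
Qed.

Lemma eq_linear_N (V : lmodType R) (f g : {linear N -> V}) :
  (forall j, (0 < j < n)%N -> f (vec_b j) = g (vec_b j)) ->
  (forall j k, (0 < j < k)%N -> (k <= n)%N -> f (vec_w j k) = g (vec_w j k)) ->
  f =1 g.
Proof.
move=> fgb fgw; apply: (@eq_linear_delta _ _ _ f g) => -[i|x].
  by rewrite delta_b fgb // (valP i) (ltn_ord (val i)).
by rewrite delta_w fgw ?(valP x) // -ltnS (ltn_ord (val x).2).
Qed.

Definition incl_basis (x : basis_index n) : M :=
  match x with
  | inl i => u ^+ i *: (vec i n.+1 - vec n n.+1)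
  | inr x => u ^+ ((val x).1 + (val x).2) *: vec (val x).1 (val x).2
  end.

Definition incl : N -> M := lin_ext incl_basis.
HB.instance Definition _ := GRing.Linear.copy incl (lin_ext incl_basis).

Lemma incl_b j : (0 < j < n)%N ->
  incl (vec_b j) = u ^+ j *: (vec j n.+1 - vec n n.+1).
Proof. by case/bP=> i -> <-; rewrite /incl lin_ext_delta. Qed.

Lemma incl_w j k : (0 < j < k)%N -> (k <= n)%N ->
  incl (vec_w j k) = u ^+ (j + k) *: vec j k.
Proof. by move=> jk /(wP jk)[x [-> <- <-]]; rewrite /incl lin_ext_delta. Qed.

Definition proj_vec (j k : nat) : N :=
  if k == n.+1 then s ^+ j *: vec_b j else s ^+ (j + k) *: vec_w j k.

Definition proj : M -> N :=
  lin_ext (fun x : pair_index n => proj_vec (val x).1 (val x).2).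
HB.instance Definition _ := GRing.Linear.copy proj
  (lin_ext (fun x : pair_index n => proj_vec (val x).1 (val x).2)).

Lemma projE j k : (0 < j < k)%N -> (k <= n.+1)%N -> proj (vec j k) = proj_vec j k.
Proof. exact: (@lin_ext_vec _ _ _ proj_vec). Qed.

Lemma proj_w j k : (0 < j < k)%N -> (k <= n)%N ->
  proj (vec j k) = s ^+ (j + k) *: vec_w j k.
Proof.
move=> jk kn; rewrite projE //; last by lia.
by rewrite /proj_vec (_ : (k == n.+1) = false) //; lia.
Qed.

Lemma proj_b j : (0 < j <= n)%N -> proj (vec j n.+1) = s ^+ j *: vec_b j.
Proof. by move=> jn; rewrite projE // /proj_vec eqxx. Qed.

Lemma inclK : cancel incl proj.
Proof.
apply: (eq_linear_N (f := proj \o incl) (g := idfun)) => [j jn|j k jk kn] /=.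
  rewrite incl_b // linearZ /= linearB /= !proj_b ?n_gt0 ?leqnn //; last by lia.
  by rewrite b_out scaler0 subr0 scalerA s_expK scale1r.
by rewrite incl_w // linearZ /= proj_w // scalerA s_expK scale1r.
Qed.

Definition aug_part (v : M) : M := (aug v : R) *: vec n n.+1.

Lemma aug_part_linear : linear aug_part.
Proof. by move=> a v x; rewrite /aug_part linearP scalerDl scalerA. Qed.

HB.instance Definition _ :=
  GRing.isLinear.Build R M M *:%R aug_part aug_part_linear.

(** The larger module splits as the image of [incl] plus the line of f_n, and [incl \o proj] is the
    projection onto the first summand. *)
Lemma projK v : incl (proj v) = v - aug_part v.
Proof.
move: v; apply: (eq_linear_vec (f := incl \o proj) (g := idfun \- aug_part)).
move=> j k jk kn /=; rewrite /aug_part augmentation_vec //.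
have [k_eq|k_neq] := eqVneq k n.+1; last first.
  have k_le : (k <= n)%N by lia.
  rewrite proj_w // linearZ /= incl_w // scalerA mulrC s_expK scale1r.
  by rewrite scale0r subr0.
rewrite scale1r k_eq proj_b; last lia.
(* For j = n both sides vanish: [proj] kills f_n, and f_n is its own [aug_part]. *)
have [->|j_neq] := eqVneq j n; first by rewrite b_out scaler0 linear0 subrr.
by rewrite linearZ /= incl_b ?scalerA 1?mulrC ?s_expK ?scale1r //; lia.
Qed.

Lemma aug_incl x : aug_part (incl x) = 0.
Proof.
move: x; apply: (eq_linear_N (f := aug_part \o incl) (g := \0)).
  move=> j jn /=; rewrite incl_b // linearZ linearB /= /aug_part.
  by rewrite !augmentation_vec ?eqxx ?subrr ?scaler0 //; lia.
move=> j k jk kn /=; rewrite incl_w // linearZ /= /aug_part.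
rewrite augmentation_vec //; last lia.
by rewrite (_ : (k == n.+1) = false) ?scale0r ?scaler0 //; lia.
Qed.

Definition act (i : nat) (x : N) : N := proj (lkb i (incl x)).
HB.instance Definition _ i := GRing.Linear.copy (act i) (proj \o lkb i \o incl).

(** The correction term of [projK] vanishes because [lkb i] preserves the augmentation and [incl x]
    has augmentation 0. Thus [act i] is a genuine restriction, not merely a compression. *)
Lemma incl_act i x : (0 < i < n)%N -> incl (act i x) = lkb i (incl x).
Proof.
move=> lt_in; rewrite projK /aug_part augmentation_lkb //.
by rewrite -/(aug_part _) aug_incl subr0.
Qed.

Lemma incl_inj : injective incl.
Proof. exact: can_inj inclK. Qed.

Definition cubic_e1 : R := 1 - u ^+ 2 + u ^+ 2 ^+ 2 * q ^+ 2.
Definition cubic_e2 : R := u ^+ 2 - (1 - u ^+ 2) * (u ^+ 2 ^+ 2 * q ^+ 2).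
Definition cubic_e3 : R := u ^+ 2 ^+ 3 * q ^+ 2.

Lemma act_cubic i : (0 < i < n)%N -> forall x,
  act i (act i (act i x))
  = cubic_e1 *: act i (act i x) + cubic_e2 *: act i x - cubic_e3 *: x.
Proof.
move=> lt_in; apply: (cubic_transport (f := incl) (h := lkb i)).
- exact: incl_inj.
- by move=> x; apply: incl_act.
- exact: lkb_cubic.
Qed.

Lemma act_far i h : (0 < i)%N -> (i.+1 < h)%N -> (h < n)%N ->
  forall x, act i (act h x) = act h (act i x).
Proof.
move=> i0 lt_ih lt_hn; apply: (commute_transport incl_inj).
- by move=> x; apply: incl_act; lia.
- by move=> x; apply: incl_act; lia.
- exact: lkb_far.
Qed.

Lemma act_near i : (0 < i)%N -> (i.+1 < n)%N ->
  forall x, act i (act i.+1 (act i x)) = act i.+1 (act i (act i.+1 x)).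
Proof.
move=> i0 lt_in; apply: (braid_transport incl_inj).
- by move=> x; apply: incl_act; lia.
- by move=> x; apply: incl_act; lia.
- exact: lkb_near.
Qed.

Lemma cubic_e3_unit : cubic_e3 \is a GRing.unit.
Proof. by rewrite unitrM !unitrX ?unitrV ?s_unit ?q_unit. Qed.

Definition act_letter (l : artin n * bool) : {linear N -> N} :=
  if l.2 then act l.1 : {linear N -> N}
  else cubic_inv (act l.1) cubic_e1 cubic_e2 cubic_e3 : {linear N -> N}.

Lemma act_rep : exists rho : linear_rep (braid n) N,
  forall (i : artin n) x, rho (sigma i) x = act i x.
Proof.
apply: (@pres_rep R N (artin n) (@braid_rel n) act_letter).
  move=> /= i e x; have lt_in : (0 < i < n)%N by rewrite (valP i) (ltn_ord (val i)).
  case: e => /=.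
    exact: (cubic_invK (act_cubic lt_in) cubic_e3_unit).
  exact: (cubicK (act_cubic lt_in) cubic_e3_unit).
move=> a b [i h lt_ih|i h h_eq] x /=.
  by rewrite act_far // ?(valP i) // (ltn_ord (val h)).
by rewrite h_eq act_near ?(valP i) // -h_eq (ltn_ord (val h)).
Qed.

(** * Explicit formulas on the basis *)

Lemma s_exp_sub a b : s ^ (a%:Z - b%:Z) = s ^+ a * u ^+ b.
Proof. by rewrite exprzDr // -exprnN -exprVn. Qed.

Lemma s_exp_sub1 a b : s ^ (a%:Z - b%:Z - 1) = s ^+ a * u ^+ b.+1.
Proof. by rewrite -s_exp_sub; congr (_ ^ _); lia. Qed.

Lemma projD : {morph proj : x y / x + y}. Proof. exact: linearD. Qed.
Lemma projN : {morph proj : x / - x}. Proof. exact: linearN. Qed.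
Lemma projZ a : {morph proj : x / a *: x}. Proof. exact: linearZ. Qed.

Lemma act_w i j k : (0 < j < k)%N -> (k <= n)%N ->
  act i (vec_w j k) = u ^+ (j + k) *: proj (lkb_vec i j k).
Proof.
by move=> jk kn; rewrite /act incl_w // !linearZ /= lkbE //; lia.
Qed.

Lemma act_b i j : (0 < j < n)%N ->
  act i (vec_b j) = u ^+ j *: (proj (lkb_vec i j n.+1)
    - proj (lkb_vec i n n.+1)).
Proof.
move=> jn; rewrite /act incl_b //.
by rewrite lkbZ lkbD lkbN projZ projD projN !lkbE //; lia.
Qed.

Ltac act_eval :=
  rewrite /lkb_vec /lkb_coef; nat_eqs; rewrite ?(projD, projN, projZ);
  repeat (rewrite proj_b; [| lia]); repeat (rewrite proj_w; [| lia | lia]);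
  rewrite ?(scalerDr, scalerN, scalerA).

(** Restoring the m cancelled pairs u s turns a scalar identity that relies on u s = 1 into a
    polynomial one in independent u and s, within reach of [ring]. *)
Lemma cancel_s m (x y : R) : x = y * (u ^+ m * s ^+ m) -> x = y.
Proof. by rewrite s_expK mulr1. Qed.

Ltac scalar_eq m :=
  congr (_ *: _); apply: (@cancel_s m); rewrite ?(exprD, exprS, expr0); ring.

Lemma act_w_disjoint i j k : (0 < j < k)%N -> (k <= n)%N ->
  [/\ j != i, j != i.+1, k != i & k != i.+1] -> act i (vec_w j k) = vec_w j k.
Proof.
move=> jk kn [? ? ? ?]; rewrite act_w //; act_eval.
by rewrite s_expK scale1r.
Qed.

Lemma act_w_succl i j : (0 < i)%N -> (i.+1 < j <= n)%N ->
  act i (vec_w i.+1 j) = u *: vec_w i j.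
Proof.
move=> i0 jn; rewrite act_w; try lia; act_eval.
scalar_eq (i + j)%N.
Qed.

Lemma act_w_succr i j : (0 < j < i)%N -> (i < n)%N ->
  act i (vec_w j i.+1) = u *: vec_w j i.
Proof.
move=> ji lt_in; rewrite act_w; try lia; act_eval.
scalar_eq (j + i)%N.
Qed.

Lemma act_w_left i j : (0 < i)%N -> (i.+1 < j <= n)%N ->
  act i (vec_w i j)
  = u *: vec_w i.+1 j + (1 - s ^- 2) *: vec_w i j
    - (s ^ (i%:Z - j%:Z - 1) * (1 - s ^- 2) * q ^+ 2) *: vec_w i i.+1.
Proof.
move=> i0 jn; rewrite act_w; try lia; act_eval.
rewrite s_exp_sub1 -exprVn -scaleNr.
congr (_ + _ + _); [scalar_eq (i + j).+1|scalar_eq (i + j)%N|scalar_eq i.+1].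
Qed.

Lemma act_w_adjacent i : (0 < i < n)%N ->
  act i (vec_w i i.+1) = (s ^- 4 * q ^+ 2) *: vec_w i i.+1.
Proof.
move=> lt_in; rewrite act_w; try lia; act_eval.
rewrite -exprVn; scalar_eq (i + i).+1.
Qed.

Lemma act_w_right i j : (0 < j < i)%N -> (i < n)%N ->
  act i (vec_w j i)
  = u *: vec_w j i.+1 + (1 - s ^- 2) *: vec_w j i
    - (s ^ (i%:Z - j%:Z - 1) * (1 - s ^- 2)) *: vec_w i i.+1.
Proof.
move=> ji lt_in; rewrite act_w; try lia; act_eval.
rewrite s_exp_sub1 -exprVn.
congr (_ + _ - _); [scalar_eq (i + j).+1|scalar_eq (i + j)%N|scalar_eq i.+1].
Qed.

Lemma act_b_disjoint i j : (0 < j < n)%N -> (i.+1 < n)%N -> j != i -> j != i.+1 ->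
  act i (vec_b j) = vec_b j.
Proof.
move=> jn lt_in ? ?; rewrite act_b //; act_eval.
by rewrite b_out !scaler0 subr0 s_expK scale1r.
Qed.

Lemma act_b_eq i : (0 < i)%N -> (i.+1 < n)%N ->
  act i (vec_b i) = (s ^ (i%:Z - n%:Z) * t) *: vec_w i i.+1
    + (1 - s ^- 2) *: vec_b i + u *: vec_b i.+1.
Proof.
move=> i0 lt_in; rewrite act_b; try lia; act_eval.
rewrite b_out scaler0 subr0 addrC [X in _ + X = _]addrC addrA.
rewrite s_exp_sub -exprVn.
congr (_ + _ + _); [scalar_eq i.+1|scalar_eq i|scalar_eq i.+1].
Qed.

Lemma act_b_succ i : (0 < i)%N -> (i.+1 < n)%N ->
  act i (vec_b i.+1) = u *: vec_b i.
Proof.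
move=> i0 lt_in; rewrite act_b; try lia; act_eval.
rewrite b_out scaler0 subr0; scalar_eq i.
Qed.

(** Here sigma_{n-1} fixes f_j but moves the reference vector f_n to f_{n-1}; the extra term is this
    shift, rescaled. *)
Lemma act_b_last i j : i.+1 = n -> (0 < j < i)%N ->
  act i (vec_b j) = vec_b j - s ^ (n%:Z - j%:Z - 1) *: vec_b i.
Proof.
move=> n_eq jn; rewrite act_b; last lia; act_eval.
have sn : s ^+ n = s * s ^+ i by rewrite -n_eq exprS.
rewrite s_expK scale1r s_exp_sub1 sn; congr (_ - _).
(* The surplus pair u s sits on the right-hand side, so the sides are exchanged first. *)
symmetry; scalar_eq 1%N.
Qed.

Lemma act_b_last_eq i : i.+1 = n -> (0 < i)%N ->
  act i (vec_b i) = (u * t) *: vec_w i n - s ^- 2 *: vec_b i.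
Proof.
move=> n_eq i0; rewrite act_b; last lia; act_eval.
rewrite n_eq b_out scaler0 add0r addrAC -scalerBl addrC -exprVn -scaleNr.
congr (_ + _); [scalar_eq (i + n)%N|scalar_eq i].
Qed.

End Action.

Theorem proposition5p3 (n : nat) (hn : (2 <= n)%N) :
  exists rho : linear_rep (braid n) (Nmod n),
    forall i : artin n,
      (* action on the w_{j,k} *)
      (forall j k : nat, (1 <= j < k)%N -> (k <= n)%N ->
         [/\ j != i, j != i.+1, k != i & k != i.+1] ->
         rho (sigma i) (w j k) = w j k) /\
      (forall j : nat, (i.+1 < j <= n)%N ->
         rho (sigma i) (w i.+1 j) = s^-1 *: w i j) /\
      (forall j : nat, (1 <= j < i)%N ->
         rho (sigma i) (w j i.+1) = s^-1 *: w j i) /\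
      (forall j : nat, (i.+1 < j <= n)%N ->
         rho (sigma i) (w i j)
         = s^-1 *: w i.+1 j + (1 - s ^- 2) *: w i j
           - (s ^ (i%:Z - j%:Z - 1) * (1 - s ^- 2) * q ^+ 2) *: w i i.+1) /\
      (rho (sigma i) (w i i.+1) = (s ^- 4 * q ^+ 2) *: w i i.+1) /\
      (forall j : nat, (1 <= j < i)%N ->
         rho (sigma i) (w j i)
         = s^-1 *: w j i.+1 + (1 - s ^- 2) *: w j i
           - (s ^ (i%:Z - j%:Z - 1) * (1 - s ^- 2)) *: w i i.+1) /\
      (* action on the b'_j *)
      ((i : nat) <> n.-1 ->
         (forall j : nat, (1 <= j <= n.-1)%N -> j != i -> j != i.+1 ->
            rho (sigma i) (b' j) = b' j) /\
         rho (sigma i) (b' i)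
           = (s ^ (i%:Z - n%:Z) * t) *: w i i.+1 + (1 - s ^- 2) *: b' i
             + s^-1 *: b' i.+1 /\
         rho (sigma i) (b' i.+1) = s^-1 *: b' i) /\
      ((i : nat) = n.-1 ->
         (forall j : nat, (1 <= j <= n.-1)%N -> j != n.-1 ->
            rho (sigma i) (b' j)
            = b' j - s ^ (n%:Z - j%:Z - 1) *: b' n.-1) /\
         rho (sigma i) (b' n.-1)
           = (s^-1 * t) *: w n.-1 n - s ^- 2 *: b' n.-1).
Proof.
have n0 : (0 < n)%N by lia.
have [rho rhoE] := @act_rep Lam n q s t n0 q_unit s_unit.
exists rho => i; have i_gt0 : (0 < i)%N := valP i.
have lt_in : (i < n)%N := ltn_ord (val i).
split; [|split; [|split; [|split; [|split; [|split; [|split]]]]]].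
(* All arguments are explicit: unification over the concrete ring [Lam]        *)
(* otherwise unfolds the fraction field and diverges.                          *)
- move=> j k jk kn ijk; rewrite rhoE.
  exact: (@act_w_disjoint Lam n q s t n0 q_unit s_unit i j k jk kn ijk).
- move=> j jn; rewrite rhoE.
  exact: (@act_w_succl Lam n q s t n0 q_unit s_unit i j i_gt0 jn).
- move=> j ji; rewrite rhoE.
  exact: (@act_w_succr Lam n q s t n0 q_unit s_unit i j ji lt_in).
- move=> j jn; rewrite rhoE.
  exact: (@act_w_left Lam n q s t n0 q_unit s_unit i j i_gt0 jn).
- have lt0in : (0 < i < n)%N by rewrite i_gt0.
  rewrite rhoE.
  exact: (@act_w_adjacent Lam n q s t n0 q_unit s_unit i lt0in).
- move=> j ji; rewrite rhoE.
  exact: (@act_w_right Lam n q s t n0 q_unit s_unit i j ji lt_in).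
- move=> i_neq; have lt_iSn : (i.+1 < n)%N by lia.
  split=> [j jn ji jiS|]; rewrite rhoE.
    have {}jn : (0 < j < n)%N by lia.
    exact: (@act_b_disjoint Lam n q s t n0 q_unit s_unit i j jn lt_iSn ji jiS).
  split; last rewrite rhoE.
    exact: (@act_b_eq Lam n q s t n0 q_unit s_unit i i_gt0 lt_iSn).
  exact: (@act_b_succ Lam n q s t n0 q_unit s_unit i i_gt0 lt_iSn).
- move=> i_eq; have iS : i.+1 = n by lia.
  rewrite -i_eq; split=> [j jn ji|]; rewrite rhoE.
    have {}jn : (0 < j < i)%N by lia.
    exact: (@act_b_last Lam n q s t n0 q_unit s_unit i j iS jn).
  exact: (@act_b_last_eq Lam n q s t n0 q_unit s_unit i iS i_gt0).
Qed.
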